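(* Let $n \geq 1$ be an integer and let $P \subseteq \mathbf{R}^n$ be a parallelepiped. Then $P$ is the union of countably infinitely many pairwise disjoint congruent sets; that is, there exist a set $A \subseteq \mathbf{R}^n$ and a sequence $(b_m)_{m=1}^{\infty}$ of vectors in $\mathbf{R}^n$ such that the translates $A + b_m$ $(m = 1, 2, 3, \ldots)$ are pairwise disjoint (i.e. $(A+b_m) \cap (A+b_{m'}) = \emptyset$ whenever $m \neq m'$) and \[ P = \bigcup_{m=1}^{\infty} (A + b_m). \]
   Context: A parallelepiped in $\mathbf{R}^n$ is a set of the form \[ P = \left\{ \sum_{i=1}^n t_i \mathbf{v}_i : t_i \in I_i \text{ for all } i \in \{1,\ldots,n\} \right\}, \] where $\{\mathbf{v}_1, \ldots, \mathbf{v}_n\}$ is a linearly independent set of vectors in $\mathbf{R}^n$ and $I_1, \ldots, I_n$ are finite (bounded) intervals of positive length in $\mathbf{R}$, each of which may be open, closed, or half-open, half-closed. For $A \subseteq \mathbf{R}^n$ and $b \in \mathbf{R}^n$, $A + b = \{a + b : a \in A\}$. Sets are called congruent if each of them is a translate of one fixed set $A$. The axiom of choice is assumed. *)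

(* Defs.v *)
From HB Require Import structures.
From mathcomp Require Import all_boot all_order all_algebra.
From mathcomp Require Import all_classical all_reals.

Set Implicit Arguments.
Unset Strict Implicit.
Unset Printing Implicit Defensive.

Import Order.TTheory GRing.Theory Num.Theory.

Local Open Scope classical_set_scope.
Local Open Scope ring_scope.

(* The booleans l and r select, independently at each endpoint, whether it
   belongs to the interval, so all four open/closed types are covered. *)
Definition bounded_positive_length (R : realType) (I : interval R) : Prop :=
  exists (a b : R) (l r : bool),
    a < b /\ I = Interval (BSide l a) (BSide r b).

Definition is_parallelepiped (R : realType) (n : nat) (P : set 'rV[R]_n) : Prop :=
  exists (v : n.-tuple 'rV[R]_n) (I : 'I_n -> interval R),
    [/\ free v,
        forall i, bounded_positive_length (I i) &
        P = [set x | exists2 t : 'I_n -> R,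
                       forall i, t i \in I i & x = \sum_(i < n) t i *: tnth v i]].

Definition translate (R : realType) (n : nat) (A : set 'rV[R]_n)
    (b : 'rV[R]_n) : set 'rV[R]_n :=
  [set a + b | a in A].

(* Main.v *)
Require Import Defs.
From HB Require Import structures.
From mathcomp Require Import all_boot all_order all_algebra.
From mathcomp Require Import all_classical all_reals.
From mathcomp Require Import ring lra zify.

Set Implicit Arguments.
Unset Strict Implicit.
Unset Printing Implicit Defensive.

Import Order.TTheory GRing.Theory Num.Theory.

Local Open Scope classical_set_scope.
Local Open Scope ring_scope.

(** Only one edge of the parallelepiped matters: if the coefficient interval of
    [v_0] is a disjoint union of translates [A1 + b m], then the points whose
    coefficient along [v_0] lies in [A1] form a set whose translates by
    [b m *: v_0] tile the parallelepiped; freeness of [v] makes the coefficient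
    well defined.  An affine change of variable reduces to an interval with
    endpoints 0 and 1, which is von Neumann's theorem that an interval is a
    disjoint union of countably many translates of one set.

    For that theorem a single translation sequence [b] serves all four kinds of
    intervals.  It runs in [[0, 1/3]], starts with 0 and 1/3, is dense there, and
    [b m] has 3-adic denominator exactly [3 ^ m].  The last property makes [b]
    behave like an independent family: if [x] has denominator dividing [3 ^ e],
    then [x + b l = b m + b i] with [m > e] forces [l = m] or [l = i]
    ([triadic_sidon]).

    Work in one coset of the countable group of triadic rationals and build the
    set of base points greedily along an enumeration of the coset.  Let [p] be a
    point of the open unit interval missed by the finitely many translates
    [a + b] chosen so far, [b] standing also for the range of the sequence.  By
    density some [b m] with [m] beyond the denominators of all the differences
    [p - a] is such that [p - b m] lies strictly between 0 and 2/3, so that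
    [p - b m + b] stays inside the interval.  An intersection of this translate
    with [a + b] would read [(p - a) + b l = b m + b i]; either outcome of the
    Sidon property puts [p] in [a + b], contrary to the choice of [p].  An endpoint
    belonging to the interval is the only kind of point that leaves no freedom:
    0 has to be 0 + 0, and 1 has to be 2/3 + 1/3.  So the greedy process starts
    from the base points 0 or 2/3 that the endpoints require; their translates
    cannot meet, as 2/3 exceeds the diameter of [b].

    Two translates that meet have base points in a common coset, so the packings
    obtained in the various cosets can be put together ([unit_interval_tiling]);
    choosing them simultaneously uses the axiom of choice. *)

(** * Packings by translates and their greedy completion *)

(** The conclusion [m = m'] alone makes the translates of [A] disjoint, and then
    [a = a'] follows by cancellation. *)
Definition packs (V : zmodType) (b : nat -> V) (A : set V) :=
  forall a a' m m', A a -> A a' -> a + b m = a' + b m' -> m = m'.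

Definition covered (V : zmodType) (b : nat -> V) (A : set V) (p : V) :=
  exists a m, A a /\ p = a + b m.

(** A packing that starts from [s0] and is completed one point at a time covers
    every listed point of [J], as soon as any finite stage missing a point [p]
    can be enlarged by a base point of the form [p - b m].  [Q] is the set where
    base points are allowed. *)
Lemma greedy_packing (V : zmodType) (b : nat -> V) (Q J : set V)
    (e : nat -> V) (s0 : seq V) :
  injective b ->
  packs b [set` s0] -> [set` s0] `<=` Q ->
  (forall (s : seq V) p, {subset s0 <= s} -> J p -> ~ covered b [set` s] p ->
     exists m, Q (p - b m) /\
       forall a l i, a \in s -> p - b m + b l <> a + b i) ->
  exists A : set V, [/\ A `<=` Q, packs b A, [set` s0] `<=` A &
    forall k, J (e k) -> covered b A (e k)].
Proof.
move=> b_inj s0_packs s0Q step.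
pose inv (s : seq V) :=
  [/\ {subset s0 <= s}, [set` s] `<=` Q & packs b [set` s]].
have [f fP] : exists f : seq V * nat -> seq V, forall sk, inv sk.1 ->
    [/\ inv (f sk), {subset sk.1 <= f sk} &
        J (e sk.2) -> covered b [set` f sk] (e sk.2)].
  suff /choice[f fP] : forall sk : seq V * nat, exists s', inv sk.1 ->
      [/\ inv s', {subset sk.1 <= s'} &
          J (e sk.2) -> covered b [set` s'] (e sk.2)] by exists f.
  move=> [s k] /=.
  have [[s0s sQ s_packs]|ninv] := pselect (inv s); last by exists s.
  have [cov|ncov] := pselect (J (e k) -> covered b [set` s] (e k)).
    by exists s => inv_s; split.
  have [Jk nk] : J (e k) /\ ~ covered b [set` s] (e k).
    by split; [apply: contrapT => nJ | move=> c]; apply: ncov.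
  have [m [Qm mP]] := step s _ s0s Jk nk.
  exists (e k - b m :: s) => _; split.
  - split.
    + by move=> x xs; rewrite inE s0s ?orbT.
    + by move=> x /=; rewrite inE => /orP[/eqP->//|/sQ].
    + move=> a a' i i' /=; rewrite !inE.
      move=> /orP[/eqP->|as_] /orP[/eqP->|as'].
      * by move=> /addrI/b_inj.
      * by move=> /mP; case/(_ as').
      * by move=> /esym/mP; case/(_ as_).
      * exact: s_packs.
  - by move=> x xs; rewrite inE xs orbT.
  - by move=> _; exists (e k - b m), m; rewrite /= mem_head subrK.
pose fix S (k : nat) : seq V := if k is k'.+1 then f (S k', k') else s0.
have S_inv k : inv (S k).
  elim: k => [|k IH]; first by split.
  by have [] := fP (S k, k) IH.
have S_sub i j : {subset S i <= S (j + i)%N}.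
  elim: j => [|j IH] // x /IH xs /=.
  by have [_ + _] := fP (S (j + i)%N, (j + i)%N) (S_inv _); apply.
exists (\bigcup_k [set` S k]); split.
- by move=> a [k _]; have [_ + _] := S_inv k; apply.
- move=> a a' m m' [k _ /= ak] [k' _ /= ak'].
  have [_ _ +] := S_inv (k + k')%N; apply => /=; last exact: S_sub.
  by rewrite addnC; exact: S_sub.
- by move=> a as0; exists 0%N.
- move=> k Jk; have [_ _ /(_ Jk)[a [m [am ->]]]] := fP (S k, k) (S_inv k).
  by exists a, m; split=> //; exists k.+1.
Qed.

(** * A dense sequence of triadic rationals with separated denominators *)

Section Triadic.
Variable R : realType.
Implicit Types (x y : R) (k m : nat).

Definition triadic k : set R := [set x | exists z : int, x * 3 ^+ k = z%:~R].

Lemma triadic0 k : triadic k 0.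
Proof. by exists 0; rewrite mul0r. Qed.

Lemma triadicD k x y : triadic k x -> triadic k y -> triadic k (x + y).
Proof. by move=> [z hz] [t ht]; exists (z + t); rewrite mulrDl hz ht intrD. Qed.

Lemma triadicN k x : triadic k x -> triadic k (- x).
Proof. by move=> [z hz]; exists (- z); rewrite mulNr hz mulrNz. Qed.

Lemma triadicB k x y : triadic k x -> triadic k y -> triadic k (x - y).
Proof. by move=> hx hy; apply: triadicD hx (triadicN hy). Qed.

Lemma triadicW k m x : (k <= m)%N -> triadic k x -> triadic m x.
Proof.
move=> /subnKC <- [z hz]; exists (z * 3 ^+ (m - k)%N).
by rewrite exprD mulrA hz intrM rmorphXn.
Qed.

(** With [s] the integer part of the base 3 logarithm of [m > 0], the value
    [tri_seq m] is [j / 3 ^ s.+1 + 1 / 3 ^ m] where [j = m mod 3 ^ s]: as [m] runs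
    through an interval between consecutive powers of 3 the first term sweeps a
    regular grid of [[0, 1/3]], and the second forces the exact denominator. *)
Definition tri_num m : nat :=
  let s := trunc_log 3 m in
  if m is 0 then 0 else (m %% 3 ^ s * 3 ^ (m - s.+1) + 1)%N.

Definition tri_seq m : R := (tri_num m)%:R / 3 ^+ m.

Lemma trunc_log3_lt m : (1 < m)%N -> ((trunc_log 3 m).+1 < m)%N.
Proof.
move=> m1; have: (3 ^ trunc_log 3 m <= m)%N by rewrite trunc_logP // ltnW.
case: (trunc_log 3 m) => [|s]; first by [].
rewrite expnS; have := ltn_expl s (isT : (1 < 3)%N); lia.
Qed.

Lemma trunc_log3_leS m : (0 < m)%N -> ((trunc_log 3 m).+1 <= m)%N.
Proof. by case: m => [|[|m]] // _; exact/ltnW/trunc_log3_lt. Qed.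

Lemma tri_num_mod3 m : (0 < m)%N -> exists q, tri_num m = (q * 3 + 1)%N.
Proof.
case: m => [//|[|m]] _; first by exists 0%N.
rewrite /tri_num.
have := trunc_log3_lt (isT : (1 < m.+2)%N); move: (trunc_log 3 _) => s hs.
have -> : (m.+2 - s.+1 = (m - s).+1)%N by lia.
by exists (m.+2 %% 3 ^ s * 3 ^ (m - s))%N; rewrite expnS; lia.
Qed.

Lemma triadic_tri_seq m : triadic m (tri_seq m).
Proof.
by exists (tri_num m); rewrite /tri_seq divfK // expf_neq0 // pnatr_eq0.
Qed.

(** The case [c = 2] treats the sum [b m + b m] in the Sidon property; it is the
    reason for working in base 3 rather than 2. *)
Lemma triadic_seqMn_pred c m :
  (0 < c < 3)%N -> ~ triadic m (tri_seq m.+1 *+ c).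
Proof.
move=> hc [z]; rewrite /tri_seq.
have [q ->] := tri_num_mod3 (ltn0Sn m).
have -> : (q * 3 + 1)%:R / 3 ^+ m.+1 *+ c * 3 ^+ m
          = (q * 3 + 1)%:R * c%:R / 3 :> R.
  by rewrite -mulr_natr exprS; field; rewrite expf_neq0 ?pnatr_eq0.
move=> /(congr1 (fun x => x * 3)).
rewrite divfK ?pnatr_eq0 // -natrM => h.
have : ((q * 3 + 1) * c)%N%:Z = z * 3.
  by apply/eqP; rewrite -(eqr_int R) intrM -h; apply/eqP.
by move: hc; case: c {h} => [|[|[|]]] //; lia.
Qed.

Lemma not_triadic_lt k m : (k < m)%N -> ~ triadic k (tri_seq m).
Proof.
case: m => [//|m]; rewrite ltnS => km /(triadicW km).
exact: (@triadic_seqMn_pred 1).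
Qed.

Lemma tri_seq_inj : injective tri_seq.
Proof.
have lt_neq k m : (k < m)%N -> tri_seq k <> tri_seq m.
  by move=> km ekm; apply: (not_triadic_lt km); rewrite -ekm; exact: triadic_tri_seq.
by move=> k m ekm; have [/lt_neq|/lt_neq/(_ (esym ekm))|] := ltngtP k m.
Qed.

(** Were [l] distinct from [m] and [i], the term of largest index, which is at
    least [m > e], would occur on one side only (possibly twice, when [m = i]),
    and its denominator could not be cancelled by the other terms. *)
Lemma triadic_sidon e m l i x : (e < m)%N -> triadic e x ->
  x + tri_seq l = tri_seq m + tri_seq i -> l = m \/ l = i.
Proof.
move=> em xe xl.
have [|/eqP lm] := eqVneq l m; first by left.
have [|/eqP li] := eqVneq l i; first by right.
exfalso.
wlog im : m i em xl lm li / (i <= m)%N => [th|].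
  have [im|mi] := leqP i m; first exact: (th m i).
  by apply: (th i m) => //; [exact: ltn_trans mi|rewrite xl addrC|exact: ltnW].
have T k j : (j <= k)%N -> triadic k (tri_seq j).
  by move=> jk; exact: triadicW jk (triadic_tri_seq j).
have X k : (e <= k)%N -> triadic k x by move=> ek; exact: triadicW ek xe.
have [ml|l_lt_m] : (m < l \/ l < m)%N by lia.
  case: l => [|l] // in lm li xl ml *.
  apply: (@not_triadic_lt l l.+1) => //.
  have -> : tri_seq l.+1 = tri_seq m + tri_seq i - x by rewrite -xl addrC addKr.
  by apply: triadicB; [apply: triadicD; apply: T; lia|apply: X; lia].
case: m => [|m] // in em lm xl im l_lt_m *.
have [iE|i_lt_m] : i = m.+1 \/ (i < m.+1)%N by lia.
  apply: (@triadic_seqMn_pred 2 m) => //.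
  rewrite mulr2n -[in X in _ + X]iE -xl.
  by apply: triadicD; [apply: X; lia|apply: T; lia].
apply: (@not_triadic_lt m m.+1) => //.
have -> : tri_seq m.+1 = x + tri_seq l - tri_seq i by rewrite xl addrK.
by apply: triadicB; [apply: triadicD; [apply: X; lia|apply: T; lia]|apply: T; lia].
Qed.

Lemma tri_seq0 : tri_seq 0 = 0.
Proof. by rewrite /tri_seq mul0r. Qed.

Lemma tri_seq1 : tri_seq 1 = 1 / 3.
Proof. by rewrite /tri_seq /tri_num /= modn1 mul0n expr1. Qed.

Lemma tri_seqE m : (0 < m)%N -> let s := trunc_log 3 m in
  tri_seq m = (m %% 3 ^ s)%:R / 3 ^+ s.+1 + 1 / 3 ^+ m.
Proof.
move=> m0 s; rewrite /tri_seq /tri_num -/s; case: m => // m in m0 s *.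
have sm : (s.+1 <= m.+1)%N by exact: trunc_log3_leS.
rewrite natrD natrM natrX -[in 3 ^+ m.+1](subnKC sm) exprD.
by field; rewrite !expf_neq0 ?pnatr_eq0.
Qed.

Lemma tri_seq_itv m : 0 <= tri_seq m <= 1 / 3.
Proof.
rewrite divr_ge0 ?ler0n ?exprn_ge0 //=.
case: m => [|m]; first by rewrite tri_seq0; lra.
rewrite tri_seqE //; set s := trunc_log 3 _.
have ms : (m.+1 %% 3 ^ s < 3 ^ s)%N by rewrite ltn_pmod // expn_gt0.
have sm : (s.+1 <= m.+1)%N by exact: trunc_log3_leS.
have h : 1 / 3 ^+ m.+1 <= 1 / 3 ^+ s.+1 :> R.
  by rewrite !div1r lef_pV2 ?posrE ?exprn_gt0 ?ler_eXn2l // ?ltr1n.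
apply: (le_trans (lerD (lexx _) h)); rewrite -mulrDl natr1.
rewrite ler_pdivrMr ?exprn_gt0 // exprS mulrA divfK ?pnatr_eq0 // mul1r.
by rewrite -natrX ler_nat.
Qed.

Lemma tri_seq_dense (u v : R) (N : nat) : 0 <= u -> u < v -> v <= 1 / 3 ->
  exists2 m, (N < m)%N & u < tri_seq m < v.
Proof.
move=> u0 uv v3.
(* A grid of step [1 / 3 ^ s.+1 < (v - u) / 2] has a point just below the
   midpoint [c], and the extra term [1 / 3 ^ m] is at most one step. *)
pose s := maxn N (Num.bound (2 / (v - u))).
pose c := (u + v) / 2.
pose j := Num.truncn (c * 3 ^+ s.+1).
have s3 : (s < 3 ^ s)%N by exact: ltn_expl.
have P0 : 0 < 3 ^+ s.+1 :> R by rewrite exprn_gt0.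
have c0 : 0 <= c by rewrite /c; lra.
have /andP[j1 j2] : j%:R <= c * 3 ^+ s.+1 < j.+1%:R.
  by apply: truncn_itv; rewrite mulr_ge0 // ltW.
have js : (j < 3 ^ s)%N.
  rewrite -(ltr_nat R) natrX; apply: le_lt_trans j1 _.
  by rewrite exprS mulrA gtr_pMl ?exprn_gt0 // /c; lra.
have mE : trunc_log 3 (3 ^ s + j) = s.
  apply: trunc_log_eq => //; rewrite leq_addr /= expnS; lia.
exists (3 ^ s + j)%N.
  apply: leq_trans (leq_addr _ _); apply: leq_ltn_trans s3; exact: leq_maxl.
rewrite tri_seqE ?addn_gt0 ?expn_gt0 // mE modnDl modn_small //.
have e0 : 0 < 1 / 3 ^+ (3 ^ s + j) :> R by rewrite divr_gt0 ?exprn_gt0.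
have e1 : 1 / 3 ^+ (3 ^ s + j) <= 1 / 3 ^+ s.+1 :> R.
  rewrite !div1r lef_pV2 ?posrE ?exprn_gt0 ?ler_eXn2l // ?ltr1n //.
  by apply: leq_trans (leq_addr _ _).
have d : 1 / 3 ^+ s.+1 < (v - u) / 2.
  rewrite -[(v - u) / 2]invf_div div1r ltf_pV2 ?posrE ?exprn_gt0 ?divr_gt0 //; last lra.
  apply: lt_trans (archi_boundP _) _; first by rewrite divr_ge0 // subr_ge0 ltW.
  rewrite -natrX ltr_nat (leq_ltn_trans (leq_maxr N _)) // -/s.
  by rewrite expnS; lia.
have h1 : j%:R / 3 ^+ s.+1 <= c by rewrite ler_pdivrMr.
have h2 : c < j%:R / 3 ^+ s.+1 + 1 / 3 ^+ s.+1.
  by rewrite -mulrDl natr1 ltr_pdivlMr.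
by apply/andP; split; move: h1 h2 d e1 e0; rewrite /c; lra.
Qed.

End Triadic.

(** * Tilings of intervals *)

Definition tiles (V : zmodType) (b : nat -> V) (A J : set V) :=
  packs b A /\ forall p, J p <-> covered b A p.

Lemma mem_interval01 (R : realType) (l r : bool) (p : R) :
  reflect [\/ 0 < p < 1, l /\ p = 0 | ~~ r /\ p = 1]
    (p \in Interval (BSide l 0) (BSide r 1)).
Proof.
have -> : (p \in Interval (BSide l 0) (BSide r 1)) =
    [|| 0 < p < 1, l && (p == 0) | ~~ r && (p == 1)].
  by apply/idP/idP; case: l; case: r; rewrite in_itv /= ?orbF; lra.
apply: (iffP or3P) => -[h|h|h]; [exact: Or31| | |exact: Or31| |].
- by case/andP: h => hb /eqP hp; apply: Or32.
- by case/andP: h => hb /eqP hp; apply: Or33.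
- by apply: Or32; case: h => -> ->; rewrite eqxx.
- by apply: Or33; case: h => -> ->; rewrite eqxx.
Qed.

(** In each coset, the packing may contain base points outside the coset (those
    serving the endpoints): this avoids distinguishing the cosets that contain
    the endpoints from the others. *)
Lemma coset_packing (R : realType) (l r : bool) (x : R) :
  let J : set R := [set` Interval (BSide l 0) (BSide r 1)] in
  exists A : set R,
    [/\ forall a m, A a -> J (a + tri_seq R m), packs (@tri_seq R) A &
        forall p k, triadic k (p - x) -> J p -> covered (@tri_seq R) A p].
Proof.
move=> J.
pose Q : set R := [set a | forall m, J (a + tri_seq R m)].
pose s0 : seq R := nseq l 0 ++ nseq (~~ r) (2 / 3).
have s0E a : a \in s0 -> (l /\ a = 0) \/ (~~ r /\ a = 2 / 3).
  rewrite mem_cat !mem_nseq !lt0b => /orP[] /andP[? /eqP]; by [left|right].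
pose e k : R :=
  if unpickle k is Some (z, j) then x + (z : int)%:~R / 3 ^+ (j : nat) else 0.
(* The seeds [s0] force the step to treat points of the open interval only. *)
have [||s p s0s Jp np|A [AQ A_packs s0A Acov]] :=
    greedy_packing (Q := Q) (J := J) e (s0 := s0) (@tri_seq_inj R).
- move=> a a' m m' /s0E ha /s0E ha'.
  have := tri_seq_itv R m; have := tri_seq_itv R m'.
  move: ha ha' => [[_ ->]|[_ ->]] [[_ ->]|[_ ->]] h1 h2 E;
    by first [apply: (@tri_seq_inj R); exact: addrI E|exfalso; move: E; lra].
- move=> a /s0E ha m; apply/mem_interval01.
  have := tri_seq_itv R m; case: ha => -[hl ->] hm.
  + have [m0|m0] := eqVneq (tri_seq R m) 0.
      by apply: Or32; rewrite m0 addr0.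
    by apply: Or31; lra.
  + have [m0|m0] := eqVneq (tri_seq R m) (1 / 3).
      by apply: Or33; rewrite m0; split=> //; lra.
    by apply: Or31; lra.
- have p01 : 0 < p < 1.
    have /mem_interval01[//|[hl p0]|[hr p1]] := Jp; exfalso; apply: np.
    + exists 0, 0%N; rewrite tri_seq0 p0 addr0; split=> //.
      by apply: s0s; rewrite mem_cat mem_nseq lt0b hl eqxx.
    + exists (2 / 3), 1%N; rewrite tri_seq1 p1; split; last by lra.
      by apply: s0s; rewrite mem_cat !mem_nseq !lt0b hr eqxx orbT.
  (* Base points [a] with [p - a] not triadic are harmless: their translates
     cannot meet that of [p - b m].  [N] bounds the other denominators. *)
  have [N NP] : exists N, forall a k, a \in s -> triadic k (p - a) ->
      exists2 j, (j <= N)%N & triadic j (p - a).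
    elim: s {s0s np} => [|c s [N NP]]; first by exists 0%N.
    have [[k ck]|nc] := pselect (exists k, triadic k (p - c)).
      exists (maxn N k) => a i; rewrite inE => /orP[/eqP->|as_] ai.
        by exists k => //; exact: leq_maxr.
      have [j jN ja] := NP a i as_ ai.
      by exists j => //; apply: leq_trans jN (leq_maxl _ _).
    exists N => a i; rewrite inE => /orP[/eqP->|as_] ai; last exact: NP as_ ai.
    by case: nc; exists i.
  have [m Nm mP] : exists2 m, (N < m)%N &
      Num.max 0 (p - 2 / 3) < tri_seq R m < Num.min p (1 / 3).
    apply: tri_seq_dense; first by rewrite le_max lexx.
    + by rewrite gt_max !lt_min; lra.
    + by rewrite ge_min lexx orbT.
  move: mP; rewrite gt_max lt_min => /andP[/andP[m1 m2] /andP[m3 m4]].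
  exists m; split=> [i|a j i as_ eq_pa].
    by apply/mem_interval01/Or31; have := tri_seq_itv R i; lra.
  have eq_pa' : p - a + tri_seq R j = tri_seq R m + tri_seq R i.
    by move: eq_pa; lra.
  have pa_tri : triadic (maxn m (maxn i j)) (p - a).
    have -> : p - a = tri_seq R m + tri_seq R i - tri_seq R j.
      by rewrite -eq_pa' addrK.
    by apply: triadicB; [apply: triadicD|];
      (apply: triadicW (triadic_tri_seq _ _); lia).
  have [k kN ka] := NP _ _ as_ pa_tri.
  apply: np; have [jE|jE] := triadic_sidon (leq_ltn_trans kN Nm) ka eq_pa'.
  + by exists a, i; split=> //; move: eq_pa; rewrite jE; lra.
  + by exists a, m; split=> //; move: eq_pa; rewrite jE; lra.
exists A; split=> [a m /AQ||p k [z zE] Jp] //.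
have pE : e (pickle (z, k)) = p.
  rewrite /e pickleK -zE mulfK ?expf_neq0 ?pnatr_eq0 //; lra.
by rewrite -pE; apply: Acov; rewrite pE.
Qed.

(** [rep] picks one point in each coset of the triadic rationals; a point [a] is
    kept when the packing attached to its own coset contains it. *)
Lemma unit_interval_tiling (R : realType) (l r : bool) :
  exists A : set R,
    tiles (@tri_seq R) A [set` Interval (BSide l 0) (BSide r 1)].
Proof.
have [F FP] := choice (@coset_packing R l r).
pose cls (x : R) : set R := [set y | exists k, triadic k (y - x)].
pose rep x := xget 0 (cls x).
have rep_cls x : cls x (rep x).
  by apply: xgetPex; exists x, 0%N; rewrite subrr; exact: triadic0.
have cls_sub x y z k : triadic k (x - y) -> cls x z -> cls y z.
  move=> xy [j zx]; exists (maxn j k).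
  have -> : z - y = (z - x) + (x - y) by lra.
  by apply: triadicD;
    [apply: triadicW zx; exact: leq_maxl|apply: triadicW xy; exact: leq_maxr].
have rep_eq x y k : triadic k (x - y) -> rep x = rep y.
  move=> xy; rewrite /rep; congr xget; apply/seteqP; split=> z.
    exact: cls_sub xy.
  by apply: (@cls_sub _ _ _ k); rewrite -opprB; exact: triadicN.
exists [set a | F (rep a) a]; split.
  move=> a a' m m' Fa Fa' E.
  have aa' : triadic (maxn m m') (a - a').
    have -> : a - a' = tri_seq R m' - tri_seq R m by lra.
    by apply: triadicB; apply: triadicW (triadic_tri_seq _ _);
      rewrite ?leq_maxl ?leq_maxr.
  have [_ + _] := FP (rep a); apply; [exact: Fa| |exact: E].
  by rewrite (rep_eq _ _ _ aa').
move=> p; split=> [Jp|[a [m [Fa ->]]]]; last first.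
  by have [+ _ _] := FP (rep a); apply.
have [k pk] := rep_cls p.
have [_ _ /(_ p k)[||a [m [Fa pE]]]] := FP (rep p) => //.
  by rewrite -opprB; exact: triadicN.
exists a, m; split=> //=; rewrite (rep_eq a p m) //.
have -> : a - p = - tri_seq R m by rewrite pE; lra.
by apply: triadicN; exact: triadic_tri_seq.
Qed.

Lemma interval_tiling (R : realType) (I : interval R) :
  bounded_positive_length I -> exists (b : nat -> R) A, tiles b A [set` I].
Proof.
move=> [u [v [l [r [uv ->]]]]].
have w0 : v - u != 0 by rewrite subr_eq0 gt_eqF.
have [A [A_packs AP]] := unit_interval_tiling R l r.
pose f x := (x - u) / (v - u).
have fD a m : f (a + (v - u) * tri_seq R m) = f a + tri_seq R m.
  by rewrite /f; field.
have fI p : (p \in Interval (BSide l u) (BSide r v)) =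
            (f p \in Interval (BSide l 0) (BSide r 1)).
  have w : 0 < v - u by rewrite subr_gt0.
  by rewrite /f; case: l {AP}; case: r; rewrite !in_itv /=
    ?(ler_pdivlMr, ltr_pdivlMr, ler_pdivrMr, ltr_pdivrMr) // !mul0r !mul1r
    ?(subr_ge0, subr_gt0, lerD2r, ltrD2r).
exists (fun m => (v - u) * tri_seq R m), [set x | A (f x)]; split.
  move=> a a' m m' Aa Aa' /(congr1 f); rewrite !fD; exact: A_packs.
move=> p; rewrite /= fI; split=> [/AP[a [m [Aa pE]]]|[a [m [Aa ->]]]].
  exists (u + (v - u) * a), m; split => /=.
    by have -> : f (u + (v - u) * a) = a by rewrite /f; field.
  have -> : p = u + (v - u) * f p by rewrite /f; field.
  by rewrite pE; ring.
by rewrite fD; apply/AP; exists (f a), m.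
Qed.

(** * From one edge to the whole parallelepiped *)

Lemma free_sum_inj (K : fieldType) (V : vectType K) (n : nat) (v : n.-tuple V)
    (t t' : 'I_n -> K) :
  free v -> \sum_(i < n) t i *: tnth v i = \sum_(i < n) t' i *: tnth v i ->
  t =1 t'.
Proof.
move=> /freeP v_free tt' i; apply/eqP; rewrite -subr_eq0; apply/eqP.
apply: (v_free (fun i => t i - t' i)).
rewrite -[RHS](subrr (\sum_(i < n) t' i *: tnth v i)) -{1}tt' -sumrB.
by apply: eq_bigr => j _; rewrite scalerBl (tnth_nth 0).
Qed.

Theorem theorem3 (R : realType) (n : nat) (n_ge1 : (1 <= n)%N)
    (P : set 'rV[R]_n) (P_par : is_parallelepiped P) :
  exists (A : set 'rV[R]_n) (b : nat -> 'rV[R]_n),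
    trivIset setT (fun m : nat => translate A (b m)) /\
    P = \bigcup_(m : nat) translate A (b m).
Proof.
have [v [I [v_free I_pos ->]]] := P_par.
pose i0 : 'I_n := Ordinal n_ge1.
have [b [A [A_packs AP]]] := interval_tiling (I_pos i0).
pose comb (t : 'I_n -> R) := \sum_(i < n) t i *: tnth v i.
pose shift c (t : 'I_n -> R) i := if i == i0 then t i + c else t i.
have comb_shift c t : comb (shift c t) = comb t + c *: tnth v i0.
  rewrite /comb (bigD1 i0) //= [in RHS](bigD1 i0) //= /shift eqxx scalerDl.
  rewrite addrAC; congr (_ + _ + _).
  by apply: eq_bigr => i /negbTE->.
pose B := [set x | exists2 t, A (t i0) /\ (forall i, i != i0 -> t i \in I i) &
                              x = comb t].
exists B, (fun m => b m *: tnth v i0); split.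
  move=> m m' _ _ [x [[_ [t [At _] ->] <-] [_ [t' [At' _] ->]]]].
  rewrite -!comb_shift => /(free_sum_inj v_free)/(_ i0).
  by rewrite /shift eqxx => /esym; exact: A_packs.
apply/seteqP; split=> x.
  move=> [t tI ->]; have /AP[a [m [Aa tE]]] := tI i0.
  exists m => //; exists (comb (shift (- b m) t)).
    exists (shift (- b m) t) => //; split=> [|i /negbTE i_neq].
      by rewrite /shift eqxx tE addrK.
    by rewrite /shift i_neq.
  by rewrite comb_shift scaleNr subrK.
move=> [m _ [_ [t [At tI] ->] <-]].
exists (shift (b m) t); last by rewrite -comb_shift.
move=> i; rewrite /shift; case: eqVneq => [->|/tI//].
by apply/AP; exists (t i0), m.
Qed.
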